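(* Let $G$ be a graph (finite, simple, without isolated vertices). Then $G$ admits a topological integer additive set-labeling if and only if $G$ has at least one pendant vertex.
   Context: For sets $A,B$ of non-negative integers, $A+B=\{a+b: a\in A, b\in B\}$. For a non-empty finite set $X$ of non-negative integers, a topological integer additive set-labeling (TIASL) of a graph $G$ with respect to the ground set $X$ is an injective function $f:V(G)\to\mathcal{P}(X)\setminus\{\emptyset\}$ such that $f(u)+f(v)\subseteq X$ for every edge $uv\in E(G)$ and $f(V(G))\cup\{\emptyset\}$ is a topology on $X$. A graph $G$ admits a TIASL if there exist some non-empty finite set $X$ of non-negative integers and a TIASL of $G$ with respect to $X$. A pendant vertex is a vertex of degree $1$. *)

(* Defs.v *)
From mathcomp Require Import all_boot.
From mathcomp Require Import boolp classical_sets cardinality.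

Set Implicit Arguments.
Unset Strict Implicit.
Unset Printing Implicit Defensive.

Local Open Scope classical_set_scope.

Definition sumset (A B : set nat) : set nat :=
  [set (a + b)%N | a in A & b in B].

(* [tau] is a topology on the subset [X] of the ambient type [T]: the axioms
   are those of the factory [isOpenTopological], with [setT] replaced by [X];
   [X] has no type of its own here, so all members of [tau] are required to be
   subsets of [X]. That [set0] belongs to [tau] is kept explicit although it
   is also the empty union. *)
Definition is_topology_on (T : Type) (X : set T) (tau : set (set T)) : Prop :=
  [/\ forall A, tau A -> A `<=` X,
      tau set0,
      tau X,
      forall A B, tau A -> tau B -> tau (A `&` B) &
      forall (I : Type) (A : I -> set T),
        (forall i, tau (A i)) -> tau (\bigcup_i A i)].

Section Graph.
(* A finite simple graph on [V] is a symmetric irreflexive adjacency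
   relation [e]. *)
Variables (V : finType) (e : rel V).

Definition degree (v : V) : nat := #|[pred u | e v u]|.

Definition isolated (v : V) : Prop := degree v = 0.

Definition pendant (v : V) : Prop := degree v = 1.

Definition TIASL (X : set nat) (f : V -> set nat) : Prop :=
  [/\ forall v, f v `<=` X /\ f v <> set0,
      injective f,
      forall u v, e u v -> sumset (f u) (f v) `<=` X &
      is_topology_on X (range f `|` [set set0])].

Definition admits_TIASL : Prop :=
  exists X : set nat,
    [/\ finite_set X, X <> set0 & exists f : V -> set nat, TIASL X f].

End Graph.

(* Main.v *)
(** If a TIASL exists, the nonempty ground set [X] is itself the label of some
    vertex [v]. Since [X] is finite, [B + X] is contained in [X] with [B]
    nonempty only when [B] is the singleton of 0; by injectivity [v] then has
    at most one neighbour, so [v] is pendant. Conversely, let [u] be the only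
    neighbour of [v]. Label [u] with the singleton of 0, [v] with a long initial
    segment [X] of the naturals, and the other vertices with distinct initial
    segments at most half as long: this chain is a topology, and only [u] has to
    be compatible with the large label [X]. *)

Require Import Defs.
From mathcomp Require Import all_boot.
From mathcomp Require Import boolp classical_sets cardinality.

Set Implicit Arguments.
Unset Strict Implicit.
Unset Printing Implicit Defensive.

Local Open Scope classical_set_scope.

Lemma finite_set_nat_max (X : set nat) : finite_set X -> X <> set0 ->
  exists2 m, X m & forall x, X x -> x <= m.
Proof.
move=> /finite_seqP[s ->] /eqP/set0P[x0 /= x0s].
have ub x : x \in s -> x <= \max_(y <- s) y by move=> xs; apply: leq_bigmax_seq.
case: (ex_maxnP (ex_intro _ x0 x0s) ub) => m ms m_max.
by exists m.
Qed.

(** Adding an element of [B] to the maximum of [X] cannot exceed that maximum, so the element is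
    0. *)
Lemma sumset_sub_right (B X : set nat) : finite_set X -> X <> set0 ->
  B <> set0 -> sumset B X `<=` X -> B = [set 0].
Proof.
move=> Xfin Xn0 /eqP/set0P[b Bb] BX.
have [m Xm m_max] := finite_set_nat_max Xfin Xn0.
have B0 c : B c -> c = 0.
  move=> Bc; have /m_max : X (c + m) by apply: BX; exists c => //; exists m.
  by rewrite -{2}[m]add0n leq_add2r leqn0 => /eqP.
apply/seteqP; split => [c /B0 //|_ ->].
by rewrite -(B0 b Bb).
Qed.

(** The endpoint is included, so no segment is empty and [n = 0] gives the label {0}. *)
Definition initial_segment (n : nat) : set nat := [set k | k <= n].

Lemma sub_initial_segment m n :
  m <= n -> initial_segment m `<=` initial_segment n.
Proof. by move=> mn k /leq_trans; apply. Qed.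

Lemma initial_segment_inj : injective initial_segment.
Proof.
move=> m n mn; apply/eqP; rewrite eqn_leq; apply/andP; split.
- have : initial_segment m m by exact: leqnn.
  by rewrite mn.
- have : initial_segment n n by exact: leqnn.
  by rewrite -mn.
Qed.

Lemma sumset_initial_segment m n :
  sumset (initial_segment m) (initial_segment n) `<=` initial_segment (m + n).
Proof. by move=> _ [a am [b bn <-]]; apply: leq_add. Qed.

Lemma finite_initial_segment n : finite_set (initial_segment n).
Proof. exact: (finite_II n.+1). Qed.

Lemma initial_segment_neq0 n : initial_segment n <> set0.
Proof. by apply/eqP/set0P; exists 0; apply: leq0n. Qed.

(** Segments form a chain: two of them meet in the shorter one, and the bound [g v] makes any union
    equal to its longest member. *)
Lemma initial_segment_topology (V : Type) (g : V -> nat) (v : V) :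
  (forall w, g w <= g v) ->
  is_topology_on (initial_segment (g v))
    (range (fun w => initial_segment (g w)) `|` [set set0]).
Proof.
move=> g_max; split.
- move=> A [[w _ <-]|->]; last exact: sub0set.
  exact: sub_initial_segment.
- by right.
- by left; exists v.
- move=> A B [[w _ <-]|->]; last by rewrite set0I; right.
  case=> [[w' _ <-]|->]; last by rewrite setI0; right.
  left; have [ww'|/ltnW w'w] := leqP (g w) (g w').
  + by exists w => //; rewrite (setIidl (sub_initial_segment ww')).
  + by exists w' => //; rewrite (setIidr (sub_initial_segment w'w)).
- move=> I A A_open.
  (* Lengths of the nonempty members, as a boolean predicate so that [ex_maxnP] can pick the
     largest. If there are none, every member is empty and so is the union. *)
  pose is_length k := `[< exists i w, A i = initial_segment (g w) /\ g w = k >].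
  have [len_ex|no_len] := pselect (exists k, is_length k); last first.
    right; rewrite /= bigcup0// => i _.
    have [[w _ Ai]|//] := A_open i.
    by case: no_len; exists (g w); apply/asboolP; exists i, w.
  have ub k : is_length k -> k <= g v by move=> /asboolP[i [w [_ <-]]].
  case: (ex_maxnP len_ex ub) => _ /asboolP[i [w [Ai <-]]] m_max.
  left; exists w => //; apply/seteqP; split => [k wk|k [j _]].
    by exists i; rewrite ?Ai.
  have [[w' _ Aj]|->//] := A_open j.
  rewrite -Aj; apply/sub_initial_segment/m_max.
  by apply/asboolP; exists j, w'.
Qed.

Lemma TIASL_pendant (V : finType) (e : rel V) (X : set nat) (f : V -> set nat) :
  symmetric e -> (forall v, ~ isolated e v) -> finite_set X -> X <> set0 ->
  TIASL e X f -> exists v, pendant e v.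
Proof.
move=> e_sym no_isolated Xfin Xn0 [f_sub f_inj f_edge [_ _ X_open _ _]].
case: X_open => [[v _ fvX]|//]; exists v.
have nbr0 u : e v u -> f u = [set 0].
  rewrite e_sym => /f_edge; rewrite fvX.
  by apply: sumset_sub_right => //; have [] := f_sub u.
(* Injectivity only bounds the degree of [v] by 1; a neighbour exists because [v] is not
   isolated. *)
have [u vu] : exists u, e v u.
  apply/existsP; apply: contra_notT (no_isolated v) => no_nbr.
  by apply: eq_card0 => u; apply/negbTE; apply: contra no_nbr => vu;
     apply/existsP; exists u.
rewrite /pendant /degree -(card1 u); apply: eq_card => w.
apply/idP/eqP => [vw|->//].
by apply: f_inj; rewrite (nbr0 u vu) (nbr0 w vw).
Qed.

Lemma pendant_TIASL (V : finType) (e : rel V) (v : V) :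
  symmetric e -> irreflexive e -> pendant e v -> admits_TIASL e.
Proof.
move=> e_sym e_irr /eqP/card1P[u v_nbr].
have {}v_nbr w : e v w = (w == u) := v_nbr w.
have uv : (u == v) = false.
  by apply/negbTE/eqP => uv; have := v_nbr v; rewrite e_irr uv eqxx.
pose n := #|V|.
(* The successor keeps the values of the other vertices in 1..n, away from the 0 reserved for
   [u]. *)
pose g w := if w == v then n.*2 else if w == u then 0 else (enum_rank w).+1.
have gv : g v = n.*2 by rewrite /g eqxx.
have gu : g u = 0 by rewrite /g uv eqxx.
have g_small w : w != v -> g w <= n.
  by rewrite /g => /negbTE ->; case: eqP => // _; apply: ltn_ord.
(* Strict because [v] itself makes [n] positive; this separates the value of [v] from all others. *)
have n_lt : n < n.*2 by rewrite -addnn -{1}[n]addn0 ltn_add2l; apply/card_gt0P; exists v.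
have g_max w : g w <= g v.
  have [->//|/g_small gw] := eqVneq w v.
  by rewrite gv (leq_trans gw (ltnW n_lt)).
have g_inj_v w : g w = n.*2 -> w = v.
  by move=> gw; apply/eqP; apply: contraLR n_lt => /g_small; rewrite gw -leqNgt.
have g_inj : injective g.
  move=> x y; have [->|xv] := eqVneq x v; first by rewrite gv => /esym/g_inj_v.
  have [->|yv] := eqVneq y v; first by rewrite gv => /g_inj_v.
  rewrite /g (negbTE xv) (negbTE yv).
  case: eqP => [->|_]; case: eqP => [->|_] //.
  by case=> /val_inj/enum_rank_inj.
exists (initial_segment (g v)); split.
- exact: finite_initial_segment.
- exact: initial_segment_neq0.
exists (fun w => initial_segment (g w)); split.
- move=> w; split; last exact: initial_segment_neq0.
  exact: sub_initial_segment.
- by move=> x y /initial_segment_inj/g_inj.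
- move=> x y xy; apply: subset_trans (@sumset_initial_segment _ _) _.
  apply: sub_initial_segment.
  (* An edge at [v] ends in [u], which adds 0; any other edge joins two values at most [n], with sum
     at most [n.*2]. *)
  have [xv|/g_small gx] := eqVneq x v.
    by move: xy; rewrite xv v_nbr => /eqP ->; rewrite gu addn0.
  have [yv|/g_small gy] := eqVneq y v.
    by move: xy; rewrite e_sym yv v_nbr => /eqP ->; rewrite gu add0n.
  by rewrite gv -addnn leq_add.
- exact: initial_segment_topology.
Qed.

Theorem theorem2p13 (V : finType) (e : rel V)
    (e_sym : symmetric e) (e_irr : irreflexive e)
    (no_isolated : forall v : V, ~ isolated e v) :
  admits_TIASL e <-> exists v : V, pendant e v.
Proof.
split=> [[X [Xfin Xn0 [f]]]|[v]]; first exact: TIASL_pendant.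
exact: pendant_TIASL.
Qed.
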